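(* Let $G$ be a finite group, $\omega$ a normalized $3$-cocycle on $G$ with values in $\Bbbk^\times$, $L$ a subgroup of $G$ such that the class of $\omega|_{L^{\times 3}}$ is trivial, and $\psi\in C^2(L,\Bbbk^\times)$ a normalized $2$-cochain with $d\psi=\omega|_{L^{\times 3}}$. The twisted group algebra $A(L,\psi)$ admits the structure of a Frobenius algebra in $\mathsf{Vec}_G^\omega$: for $g,g'\in L$ it is given by $$m(\delta_g\otimes\delta_{g'})=\psi(g,g')\,\delta_{gg'},\qquad u(\delta_e)=\delta_e,$$ $$\Delta(\delta_g)=|L|^{-1}\sum_{h\in L}\psi^{-1}(gh,h^{-1})\,[\delta_{gh}\otimes\delta_{h^{-1}}],\qquad \varepsilon(\delta_g)=\delta_{g,e}\,|L|\,\delta_e .$$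
   Context: $\Bbbk$ is an algebraically closed field of characteristic $0$. $\mathsf{Vec}_G^\omega$: the fusion category of finite-dimensional $G$-graded $\Bbbk$-vector spaces with grading-preserving linear maps. Its simple objects are $\delta_g$ ($g\in G$), one-dimensional in degree $g$; $\delta_g$ also denotes a fixed basis vector. $(V\otimes W)_x=\bigoplus_{yz=x}V_y\otimes W_z$; associativity $\alpha_{\delta_g,\delta_{g'},\delta_{g''}}=\omega^{-1}(g,g',g'')\,\mathrm{id}:(\delta_g\otimes\delta_{g'})\otimes\delta_{g''}\to\delta_g\otimes(\delta_{g'}\otimes\delta_{g''})$; unit $\mathbf 1=\delta_e$, with $l_{\delta_g}=\omega^{-1}(e,e,g)\,\mathrm{id}$, $r_{\delta_g}=\omega(g,e,e)\,\mathrm{id}$. Cocycle condition: $\omega(g_1g_2,g_3,g_4)\omega(g_1,g_2,g_3g_4)=\omega(g_1,g_2,g_3)\omega(g_1,g_2g_3,g_4)\omega(g_2,g_3,g_4)$. The condition $d\psi=\omega|_{L^{\times3}}$ means $\psi(f_1,f_2f_3)\psi(f_2,f_3)=\omega(f_1,f_2,f_3)\psi(f_1f_2,f_3)\psi(f_1,f_2)$ for $f_i\in L$. The scalar $\delta_{g,e}$ is the Kronecker delta. Twisted group algebra: $A(L,\psi)=\bigoplus_{g\in L}\delta_g$ as an object, with multiplication $\delta_g\otimes\delta_{g'}\mapsto\psi(g,g')\delta_{gg'}$. Frobenius algebra in a monoidal category: $(A,m,u,\Delta,\varepsilon)$ where $(A,m,u)$ is an associative unital algebra, $(A,\Delta,\varepsilon)$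 a coassociative counital coalgebra, and $(m\otimes\mathrm{id})\alpha^{-1}_{A,A,A}(\mathrm{id}\otimes\Delta)=\Delta m=(\mathrm{id}\otimes m)\alpha_{A,A,A}(\Delta\otimes\mathrm{id})$. *)

(* Defs.v *)
From HB Require Import structures.
From mathcomp Require Import all_boot all_order all_algebra all_fingroup.
From mathcomp Require Import ring.

Set Implicit Arguments.
Unset Strict Implicit.
Unset Printing Implicit Defensive.

Import GRing.Theory VectorInternalTheory.
Local Open Scope ring_scope.

Record monoidal := Monoidal {
  ob : Type;
  mor : ob -> ob -> Type;
  mid : forall a, mor a a;
  mcomp : forall a b c, mor b c -> mor a b -> mor a c;
  mten : ob -> ob -> ob;
  mtenm : forall a a' b b', mor a a' -> mor b b' -> mor (mten a b) (mten a' b');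
  mone : ob;
  massoc : forall a b c, mor (mten (mten a b) c) (mten a (mten b c));
  massocV : forall a b c, mor (mten a (mten b c)) (mten (mten a b) c);
  mlunit : forall a, mor (mten mone a) a;
  mlunitV : forall a, mor a (mten mone a);
  mrunit : forall a, mor (mten a mone) a;
  mrunitV : forall a, mor a (mten a mone);
  mcomp1f : forall a b (f : mor a b), mcomp (mid b) f = f;
  mcompf1 : forall a b (f : mor a b), mcomp f (mid a) = f;
  mcompA : forall a b c d (h : mor c d) (g : mor b c) (f : mor a b),
    mcomp h (mcomp g f) = mcomp (mcomp h g) f;
  mtenm1 : forall a b, mtenm (mid a) (mid b) = mid (mten a b);
  mtenm_comp : forall a a' a'' b b' b'' (f' : mor a' a'') (f : mor a a')
      (g' : mor b' b'') (g : mor b b'),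
    mtenm (mcomp f' f) (mcomp g' g) = mcomp (mtenm f' g') (mtenm f g);
  massoc_nat : forall a a' b b' c c'
      (f : mor a a') (g : mor b b') (h : mor c c'),
    mcomp (massoc a' b' c') (mtenm (mtenm f g) h) =
    mcomp (mtenm f (mtenm g h)) (massoc a b c);
  mlunit_nat : forall a a' (f : mor a a'),
    mcomp (mlunit a') (mtenm (mid mone) f) = mcomp f (mlunit a);
  mrunit_nat : forall a a' (f : mor a a'),
    mcomp (mrunit a') (mtenm f (mid mone)) = mcomp f (mrunit a);
  massocK : forall a b c, mcomp (massocV a b c) (massoc a b c) = mid _;
  massocVK : forall a b c, mcomp (massoc a b c) (massocV a b c) = mid _;
  mlunitK : forall a, mcomp (mlunitV a) (mlunit a) = mid _;
  mlunitVK : forall a, mcomp (mlunit a) (mlunitV a) = mid _;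
  mrunitK : forall a, mcomp (mrunitV a) (mrunit a) = mid _;
  mrunitVK : forall a, mcomp (mrunit a) (mrunitV a) = mid _;
  mpentagon : forall a b c d,
    mcomp (mtenm (mid a) (massoc b c d))
      (mcomp (massoc a (mten b c) d) (mtenm (massoc a b c) (mid d))) =
    mcomp (massoc a b (mten c d)) (massoc (mten a b) c d);
  mtriangle : forall a b,
    mcomp (mtenm (mid a) (mlunit b)) (massoc a mone b) =
    mtenm (mrunit a) (mid b)
}.

Arguments mid {m} a.
Arguments mcomp {m a b c} g f : rename.
Arguments mten {m} a b.
Arguments mtenm {m a a' b b'} f g : rename.
Arguments mone {m}.
Arguments massoc {m} a b c.
Arguments massocV {m} a b c.
Arguments mlunit {m} a.
Arguments mlunitV {m} a.
Arguments mrunit {m} a.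
Arguments mrunitV {m} a.

(* A Frobenius algebra whose underlying object is [A]. *)
Record frobenius (C : monoidal) (A : ob C) := Frobenius {
  fmul : mor (mten A A) A;
  funit : mor mone A;
  fcomul : mor A (mten A A);
  fcounit : mor A mone;
  fmulA : mcomp fmul (mtenm fmul (mid A)) =
          mcomp fmul (mcomp (mtenm (mid A) fmul) (massoc A A A));
  fmul1l : mcomp fmul (mtenm funit (mid A)) = mlunit A;
  fmul1r : mcomp fmul (mtenm (mid A) funit) = mrunit A;
  fcomulA : mcomp (massoc A A A) (mcomp (mtenm fcomul (mid A)) fcomul) =
            mcomp (mtenm (mid A) fcomul) fcomul;
  fcomul1l : mcomp (mtenm fcounit (mid A)) fcomul = mlunitV A;
  fcomul1r : mcomp (mtenm (mid A) fcounit) fcomul = mrunitV A;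
  frobl : mcomp (mtenm fmul (mid A))
            (mcomp (massocV A A A) (mtenm (mid A) fcomul)) =
          mcomp fcomul fmul;
  frobr : mcomp (mtenm (mid A) fmul)
            (mcomp (massoc A A A) (mtenm fcomul (mid A))) =
          mcomp fcomul fmul
}.

Section Tensor.
Variable k : fieldType.
Implicit Types U V W T S : vectType k.

(* A tensor is the matrix of its coordinates with respect to the bases
   underlying [v2r]; its universal property is [tliftE] and [tens_ext]. *)
Definition tens V W : vectType k := 'M[k]_(dim V, dim W).

Definition tpure V W (v : V) (w : W) : tens V W := (v2r v)^T *m v2r w.

Local Notation "v ⊗ w" := (tpure v w) (at level 40, left associativity).

Definition bilin V W U (B : V -> W -> U) :=
  (forall w, linear (B^~ w)) /\ (forall v, linear (B v)).

(* The linear map with [v ⊗ w |-> B v w] when [B] is bilinear. *)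
Definition tlift_fun V W U (B : V -> W -> U) (M : tens V W) : U :=
  \sum_i \sum_j M i j *: B (r2v (delta_mx 0 i)) (r2v (delta_mx 0 j)).

Definition tlift V W U (B : V -> W -> U) : 'Hom(tens V W, U) :=
  linfun (tlift_fun B).

Lemma lin_sum V W (f : V -> W) (fL : linear f) (I : finType) (c : I -> k)
  (v : I -> V) : f (\sum_i c i *: v i) = \sum_i c i *: f (v i).
Proof.
have f0 : f 0 = 0.
  have := fL 1 0 0; rewrite !scale1r addr0 => /esym/eqP.
  by rewrite -subr_eq0 addrK => /eqP.
apply: (big_rec2 (fun x y => f x = y)) => // i y1 y2 _ <-.
by rewrite fL.
Qed.

Lemma v2r_sum V (v : V) : v = \sum_i v2r v 0 i *: r2v (delta_mx 0 i).
Proof.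
rewrite -[LHS]v2rK [v2r v in LHS]row_sum_delta linear_sum.
by apply: eq_bigr => i _; rewrite linearZ.
Qed.

Lemma tlift_fun_linear V W U (B : V -> W -> U) : linear (tlift_fun B).
Proof.
move=> a M N; rewrite /tlift_fun scaler_sumr -big_split /=.
apply: eq_bigr => i _; rewrite scaler_sumr -big_split /=.
by apply: eq_bigr => j _; rewrite !mxE scalerDl scalerA.
Qed.

HB.instance Definition _ V W U (B : V -> W -> U) :=
  GRing.isLinear.Build k (tens V W) U _ (tlift_fun B) (@tlift_fun_linear V W U B).

Lemma tpureE V W (v : V) (w : W) i j : (v ⊗ w) i j = v2r v 0 i * v2r w 0 j.
Proof. by rewrite /tpure mxE big_ord1 mxE. Qed.

Lemma tliftE V W U (B : V -> W -> U) v w :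
  bilin B -> tlift B (v ⊗ w) = B v w.
Proof.
case=> BL BR; rewrite lfunE /= /tlift_fun [v in RHS]v2r_sum (lin_sum (BL w)).
apply: eq_bigr => i _; rewrite [w in RHS]v2r_sum (lin_sum (BR _)) scaler_sumr.
by apply: eq_bigr => j _; rewrite tpureE scalerA.
Qed.

Lemma tpure_bilin V W : bilin (@tpure V W).
Proof.
have mxP m n (M N : 'M[k]_(m, n)) a i j :
  (a *: M + N) i j = a * M i j + N i j by rewrite !mxE.
split=> u a v w; apply/matrixP=> i j; rewrite mxP !tpureE linearP mxP.
  by rewrite mulrDl mulrA.
by rewrite mulrDr mulrCA.
Qed.

Lemma tpurePl V W a (v v' : V) (w : W) :
  (a *: v + v') ⊗ w = a *: (v ⊗ w) + v' ⊗ w.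
Proof. exact: (tpure_bilin V W).1. Qed.

Lemma tpurePr V W a (v : V) (w w' : W) :
  v ⊗ (a *: w + w') = a *: (v ⊗ w) + v ⊗ w'.
Proof. exact: (tpure_bilin V W).2. Qed.

HB.instance Definition _ V W (v : V) :=
  GRing.isLinear.Build k W (tens V W) _ (@tpure V W v) ((tpure_bilin V W).2 v).

Lemma tpureZl V W a (v : V) (w : W) : (a *: v) ⊗ w = a *: (v ⊗ w).
Proof. by rewrite /tpure linearZ /= linearZ /= -scalemxAl. Qed.

Lemma tpureZr V W a (v : V) (w : W) : v ⊗ (a *: w) = a *: (v ⊗ w).
Proof. exact: linearZ. Qed.

Lemma tpure0l V W (w : W) : (0 : V) ⊗ w = 0.
Proof. by rewrite -[0]/(0 : V) -(scale0r (0 : V)) tpureZl scale0r. Qed.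

Lemma tpure0r V W (v : V) : v ⊗ (0 : W) = 0.
Proof. exact: linear0. Qed.

Lemma tpure_suml V W (I : finType) (P : pred I) (f : I -> V) (w : W) :
  (\sum_(i | P i) f i) ⊗ w = \sum_(i | P i) (f i ⊗ w).
Proof.
apply: (big_morph (fun v => v ⊗ w)) => [v v'|]; last exact: tpure0l.
by have := tpurePl 1 v v' w; rewrite !scale1r.
Qed.

Lemma tpure_sumr V W (I : finType) (P : pred I) (v : V) (f : I -> W) :
  v ⊗ (\sum_(i | P i) f i) = \sum_(i | P i) (v ⊗ f i).
Proof. exact: linear_sum. Qed.

Lemma tens_sum V W (t : tens V W) :
  t = \sum_i \sum_j t i j *: (r2v (delta_mx 0 i) ⊗ r2v (delta_mx 0 j)).
Proof.
rewrite {1}[t]matrix_sum_delta; apply: eq_bigr => i _; apply: eq_bigr => j _.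
by rewrite /tpure !r2vK trmx_delta mul_delta_mx.
Qed.

Lemma tens_ext V W U (f g : 'Hom(tens V W, U)) :
  (forall v w, f (v ⊗ w) = g (v ⊗ w)) -> f = g.
Proof.
move=> fg; apply/lfunP=> t; rewrite (tens_sum t) !linear_sum.
apply: eq_bigr => i _; rewrite !linear_sum; apply: eq_bigr => j _.
by rewrite !linearZ /= fg.
Qed.

Lemma tens_ext3 V W U T (f g : 'Hom(tens (tens V W) U, T)) :
  (forall v w u, f ((v ⊗ w) ⊗ u) = g ((v ⊗ w) ⊗ u)) -> f = g.
Proof.
move=> fg; apply: tens_ext => t u; rewrite (tens_sum t) tpure_suml !linear_sum.
apply: eq_bigr => i _; rewrite tpure_suml !linear_sum; apply: eq_bigr => j _.
by rewrite tpureZl !linearZ /= fg.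
Qed.

Lemma tens_ext3' V W U T (f g : 'Hom(tens V (tens W U), T)) :
  (forall v w u, f (v ⊗ (w ⊗ u)) = g (v ⊗ (w ⊗ u))) -> f = g.
Proof.
move=> fg; apply: tens_ext => v t; rewrite (tens_sum t) tpure_sumr !linear_sum.
apply: eq_bigr => i _; rewrite tpure_sumr !linear_sum; apply: eq_bigr => j _.
by rewrite tpureZr !linearZ /= fg.
Qed.

Lemma tens_ext4 V W U T S (f g : 'Hom(tens (tens (tens V W) U) T, S)) :
  (forall v w u t, f (((v ⊗ w) ⊗ u) ⊗ t) = g (((v ⊗ w) ⊗ u) ⊗ t)) -> f = g.
Proof.
move=> fg; apply: tens_ext3 => t u z.
rewrite (tens_sum t) !tpure_suml !linear_sum.
apply: eq_bigr => i _; rewrite !tpure_suml !linear_sum; apply: eq_bigr => j _.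
by rewrite !tpureZl !linearZ /= fg.
Qed.

Definition tpurel V W (v : V) : 'Hom(W, tens V W) := linfun (tpure v).

Lemma tpurelE V W (v : V) (w : W) : tpurel W v w = v ⊗ w.
Proof. exact: lfunE. Qed.

Definition tpure_rev V W (w : W) (v : V) : tens V W := v ⊗ w.

HB.instance Definition _ V W (w : W) :=
  GRing.isLinear.Build k V (tens V W) _ (@tpure_rev V W w)
    ((tpure_bilin V W).1 w).

Definition tpurer V W (w : W) : 'Hom(V, tens V W) := linfun (tpure_rev w).

Lemma tpurerE V W (v : V) (w : W) : tpurer V w v = v ⊗ w.
Proof. exact: lfunE. Qed.

Definition tmap V V' W W' (f : 'Hom(V, V')) (g : 'Hom(W, W')) :
  'Hom(tens V W, tens V' W') := tlift (fun v w => f v ⊗ g w).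

Lemma tmapE V V' W W' (f : 'Hom(V, V')) (g : 'Hom(W, W')) v w :
  tmap f g (v ⊗ w) = f v ⊗ g w.
Proof.
by rewrite tliftE //; split=> u a x y; rewrite linearP /= ?tpurePl ?tpurePr.
Qed.

Definition trilin V W U T (B : V -> W -> U -> T) :=
  [/\ forall w u, linear (fun v => B v w u), forall v u, linear (fun w => B v w u)
    & forall v w, linear (B v w)].

Definition tlift3 V W U T (B : V -> W -> U -> T) : 'Hom(tens (tens V W) U, T) :=
  tlift (fun t u => tlift (fun v w => B v w u) t).

Definition tlift3' V W U T (B : V -> W -> U -> T) : 'Hom(tens V (tens W U), T) :=
  tlift (fun v t => tlift (fun w u => B v w u) t).

Lemma tlift3E V W U T (B : V -> W -> U -> T) v w u :
  trilin B -> tlift3 B ((v ⊗ w) ⊗ u) = B v w u.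
Proof.
case=> B1 B2 B3; rewrite tliftE.
  by rewrite tliftE //; split=> z a x y; rewrite ?B1 ?B2.
split=> [z a x y|t a x y]; first by rewrite linearP.
rewrite !lfunE /= /tlift_fun scaler_sumr -big_split; apply: eq_bigr => i _ /=.
rewrite scaler_sumr -big_split; apply: eq_bigr => j _ /=.
by rewrite B3 scalerDr !scalerA mulrC.
Qed.

Lemma tlift3'E V W U T (B : V -> W -> U -> T) v w u :
  trilin B -> tlift3' B (v ⊗ (w ⊗ u)) = B v w u.
Proof.
case=> B1 B2 B3; rewrite tliftE.
  by rewrite tliftE //; split=> z a x y; rewrite ?B2 ?B3.
split=> [t a x y|z a x y]; last by rewrite linearP.
rewrite !lfunE /= /tlift_fun scaler_sumr -big_split; apply: eq_bigr => i _ /=.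
rewrite scaler_sumr -big_split; apply: eq_bigr => j _ /=.
by rewrite B1 scalerDr !scalerA mulrC.
Qed.

Definition tensv V W (A : {vspace V}) (B : {vspace W}) : {vspace tens V W} :=
  <<[seq a ⊗ b | a <- vbasis A, b <- vbasis B]>>%VS.

Lemma mem_tensv V W (A : {vspace V}) (B : {vspace W}) a b :
  a \in A -> b \in B -> a ⊗ b \in tensv A B.
Proof.
move=> aA bB; rewrite (coord_vbasis aA) (coord_vbasis bB) tpure_suml.
apply: rpred_sum => i _; rewrite tpure_sumr; apply: rpred_sum => j _.
rewrite tpureZl tpureZr !rpredZ // memv_span //; apply/allpairsP.
by exists ((vbasis A)`_i, (vbasis B)`_j); split=> //=; rewrite mem_nth ?size_tuple.
Qed.

Lemma tensv_sub V W (A : {vspace V}) (B : {vspace W}) (S : {vspace tens V W}) :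
  (forall a b, a \in A -> b \in B -> a ⊗ b \in S) -> (tensv A B <= S)%VS.
Proof.
move=> AB; apply/span_subvP => t /allpairsP[[a b] /= [aA bB ->]].
by apply: AB; apply: vbasis_mem.
Qed.

End Tensor.

Notation "v ⊗ w" := (tpure v w) (at level 40, left associativity).

Section Graded.
Variables (k : fieldType) (gT : finGroupType).

Record gvect := GVect {
  gsort :> vectType k;
  gcomp : gT -> {vspace gsort};
  gcomp_direct : directv (\sum_x gcomp x);
  gcomp_full : (\sum_x gcomp x)%VS = fullv
}.

Implicit Types U V W X : gvect.

Definition ghom V W :=
  {f : 'Hom(V, W) | [forall x, (f @: gcomp V x <= gcomp W x)%VS]}.

Definition gapp V W (f : ghom V W) : V -> W := val f.

Lemma gapp_mem V W (f : ghom V W) x v :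
  v \in gcomp V x -> gapp f v \in gcomp W x.
Proof.
move=> vx; have /forallP/(_ x)/subvP := valP f; apply.
exact: memv_img.
Qed.

Lemma ghom_subproof V W (f : 'Hom(V, W)) :
  (forall x v, v \in gcomp V x -> f v \in gcomp W x) ->
  [forall x, (f @: gcomp V x <= gcomp W x)%VS].
Proof.
by move=> fP; apply/forallP=> x; apply/subvP=> _ /memv_imgP[v vx ->]; apply: fP.
Qed.

Definition GHom V W (f : 'Hom(V, W)) fP : ghom V W :=
  exist _ f (@ghom_subproof V W f fP).

Definition gproj V (x : gT) : 'End(V) :=
  sumv_pi (\sum_y gcomp V y)%VS x.

Lemma gproj_mem V x v : gproj V x v \in gcomp V x.
Proof. exact: memv_sum_pi. Qed.

Lemma gproj_sum V v : \sum_x gproj V x v = v.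
Proof. by apply: sumv_pi_sum; rewrite gcomp_full memvf. Qed.

Lemma gproj_id V x y v :
  v \in gcomp V x -> gproj V y v = if y == x then v else 0.
Proof.
move=> vx; pose d z := if z == x then v else 0.
have dE : \sum_z d z = v by rewrite -big_mkcond big_pred1_eq.
have dP z : true -> d z \in gcomp V z.
  by rewrite /d; case: eqP => [->//|_]; rewrite mem0v.
apply/eqP; rewrite -[_ == _]/(gproj V y v == d y).
have /directv_sum_unique/(_ (fun z => gproj V z v) d) := gcomp_direct V.
move=> /(_ (fun z _ => gproj_mem z v) dP).
by rewrite gproj_sum dE eqxx => /esym/forallP/(_ y).
Qed.

(* [directv] reads the syntax of the sum it is given, up to unfolding; the
   variable [A] keeps it from looking inside the components of the grading. *)
Definition direct_family (V : vectType k) (A : gT -> {vspace V}) :=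
  directv (\sum_x A x).

Lemma directv_proj (V : vectType k) (A : gT -> {vspace V}) (P : gT -> 'End(V)) :
  (forall x y v, v \in A y -> P x v = if x == y then v else 0) ->
  direct_family A.
Proof.
move=> PE; apply/directv_sum_independent => u uA u0 i _.
have := congr1 (P i) u0; rewrite linear0 linear_sum (bigD1 i) //= big1.
  by rewrite addr0 (PE i i) ?eqxx ?uA.
by move=> j ji; rewrite (PE i j) ?uA // eq_sym (negPf ji).
Qed.

Lemma gext (V : gvect) (T : vectType k) (f g : 'Hom(V, T)) :
  (forall x v, v \in gcomp V x -> f v = g v) -> f = g.
Proof.
move=> fg; apply/lfunP=> v; rewrite -(gproj_sum v) !linear_sum.
by apply: eq_bigr => x _; apply: (fg x); apply: gproj_mem.
Qed.

Lemma gtens_ext V W (T : vectType k) (f g : 'Hom(tens V W, T)) :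
  (forall x y v w, v \in gcomp V x -> w \in gcomp W y ->
     f (v ⊗ w) = g (v ⊗ w)) -> f = g.
Proof.
move=> fg; apply: tens_ext => v w.
rewrite -(gproj_sum v) -(gproj_sum w) tpure_suml !linear_sum.
apply: eq_bigr => x _; rewrite tpure_sumr !linear_sum.
by apply: eq_bigr => y _; apply: (fg x y); apply: gproj_mem.
Qed.

Lemma gtens_ext3 U V W (T : vectType k) (f g : 'Hom(tens (tens U V) W, T)) :
  (forall x y z u v w, u \in gcomp U x -> v \in gcomp V y -> w \in gcomp W z ->
     f ((u ⊗ v) ⊗ w) = g ((u ⊗ v) ⊗ w)) -> f = g.
Proof.
move=> fg; apply: tens_ext3 => u v w.
rewrite -(gproj_sum u) -(gproj_sum v) -(gproj_sum w).
do ![rewrite !(tpure_suml, linear_sum) /=; apply: eq_bigr => ? _].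
by apply: fg; apply: gproj_mem.
Qed.

Lemma gtens_ext3' U V W (T : vectType k) (f g : 'Hom(tens U (tens V W), T)) :
  (forall x y z u v w, u \in gcomp U x -> v \in gcomp V y -> w \in gcomp W z ->
     f (u ⊗ (v ⊗ w)) = g (u ⊗ (v ⊗ w))) -> f = g.
Proof.
move=> fg; apply: tens_ext3' => u v w.
rewrite -(gproj_sum u) -(gproj_sum v) -(gproj_sum w).
do ![rewrite !(tpure_suml, linear_sum) /=; apply: eq_bigr => ? _].
by apply: fg; apply: gproj_mem.
Qed.

Lemma gtens_ext4 U V W (S : gvect) (T : vectType k)
    (f g : 'Hom(tens (tens (tens U V) W) S, T)) :
  (forall x y z t u v w s, u \in gcomp U x -> v \in gcomp V y ->
     w \in gcomp W z -> s \in gcomp S t ->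
     f (((u ⊗ v) ⊗ w) ⊗ s) = g (((u ⊗ v) ⊗ w) ⊗ s)) -> f = g.
Proof.
move=> fg; apply: tens_ext4 => u v w s.
rewrite -(gproj_sum u) -(gproj_sum v) -(gproj_sum w) -(gproj_sum s).
do ![rewrite !(tpure_suml, linear_sum) /=; apply: eq_bigr => ? _].
by apply: fg; apply: gproj_mem.
Qed.

Definition gtens_comp V W (x : gT) : {vspace tens V W} :=
  (\sum_(p : gT * gT | (p.1 * p.2)%g == x) tensv (gcomp V p.1) (gcomp W p.2))%VS.

Lemma gtens_comp_mem V W x y v w :
  v \in gcomp V x -> w \in gcomp W y -> v ⊗ w \in gtens_comp V W (x * y)%g.
Proof.
move=> vx wy; have /subvP : (tensv (gcomp V x) (gcomp W y) <=
    gtens_comp V W (x * y)%g)%VS by apply: (sumv_sup (x, y)) => /=.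
by apply; apply: mem_tensv.
Qed.

Lemma gtens_comp_sub V W x (S : {vspace tens V W}) :
  (forall y z v w, v \in gcomp V y -> w \in gcomp W z -> (y * z)%g = x ->
     v ⊗ w \in S) -> (gtens_comp V W x <= S)%VS.
Proof.
move=> VW; apply/subv_sumP => -[y z] /= /eqP yzx.
by apply: tensv_sub => v w vy wz; apply: VW yzx.
Qed.

Lemma gtens_direct V W : direct_family (gtens_comp V W).
Proof.
pose P x := \sum_(p : gT * gT | (p.1 * p.2)%g == x)
  tmap (gproj V p.1) (gproj W p.2).
apply: (directv_proj (P := P)) => x y t.
have PE v w a b : v \in gcomp V a -> w \in gcomp W b ->
    P x (v ⊗ w) = if x == (a * b)%g then v ⊗ w else 0.
  move=> va wb; rewrite sum_lfunE (eq_bigr (fun p : gT * gT =>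
    if p == (a, b) then v ⊗ w else 0)); last first.
    move=> [c d] _; rewrite tmapE (gproj_id _ va) (gproj_id _ wb) xpair_eqE /=.
    by case: eqP; case: eqP; rewrite ?tpure0l ?tpure0r.
  rewrite -big_mkcondr /= eq_sym; case: eqP => abx.
    rewrite (big_pred1 (a, b)) // => p /=; rewrite andbC.
    by case: (p =P (a, b)) => [->|] //=; apply/eqP.
  rewrite big_pred0 // => p; rewrite andbC.
  by case: (p =P (a, b)) => [->|] //=; apply/eqP.
pose Q : 'End(tens V W) := if x == y then \1%VF else 0.
have -> : (if x == y then t else 0) = Q t.
  by rewrite /Q; case: ifP => _; rewrite ?id_lfunE ?zero_lfunE.
move: t; apply/eqlfun_inP; apply: gtens_comp_sub => a b v w va wb abE.
apply/eqlfunP; rewrite (PE _ _ _ _ va wb) abE /Q.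
by case: ifP => _; rewrite ?id_lfunE ?zero_lfunE.
Qed.


Lemma gtens_full V W : (\sum_x gtens_comp V W x)%VS = fullv.
Proof.
apply/eqP; rewrite eqEsubv subvf; apply/subvP=> t _.
rewrite (tens_sum t); apply: rpred_sum => i _; apply: rpred_sum => j _.
set v := r2v (delta_mx 0 i); set w := r2v (delta_mx 0 j).
apply: rpredZ; rewrite -(gproj_sum v) tpure_suml; apply: rpred_sum => x _.
rewrite -(gproj_sum w) tpure_sumr; apply: rpred_sum => y _.
have /subvP : (gtens_comp V W (x * y)%g <= \sum_x gtens_comp V W x)%VS.
  exact: (sumv_sup (x * y)%g).
by apply; apply: gtens_comp_mem; apply: gproj_mem.
Qed.

Definition gtens V W : gvect := GVect (gtens_direct V W) (gtens_full V W).

Lemma gtens_mem V W x y v w : v \in gcomp V x -> w \in gcomp W y ->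
  (v ⊗ w : gtens V W) \in gcomp (gtens V W) (x * y)%g.
Proof. exact: gtens_comp_mem. Qed.

Definition gunit_comp (x : gT) : {vspace k^o} :=
  if x == 1%g then fullv else 0%VS.

Lemma gunit_direct : direct_family gunit_comp.
Proof.
apply: (directv_proj (P := fun x => if x == 1%g then \1%VF else 0)) => x y v.
rewrite /gunit_comp; case: (eqVneq y 1%g) => [->|_]; last first.
  by rewrite memv0 => /eqP->; rewrite linear0; case: ifP.
by case: eqP => _ _; rewrite ?id_lfunE ?zero_lfunE.
Qed.

Lemma gunit_full : (\sum_x gunit_comp x)%VS = fullv.
Proof.
by apply/eqP; rewrite eqEsubv subvf (sumv_sup 1%g) // /gunit_comp eqxx subvv.
Qed.

Definition gunit : gvect := GVect gunit_direct gunit_full.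

Definition gunit_delta : gunit := (1 : k^o).

Lemma lfunZ (T T' : vectType k) (f : 'Hom(T, T')) a v : f (a *: v) = a *: f v.
Proof. exact: linearZ. Qed.

Lemma ghomP V W (f g : ghom V W) : val f = val g -> f = g.
Proof. exact: val_inj. Qed.

Lemma gtens_pres V W X (f : 'Hom(gtens V W, X)) :
  (forall x y v w, v \in gcomp V x -> w \in gcomp W y ->
     f (v ⊗ w) \in gcomp X (x * y)%g) ->
  forall x t, t \in gcomp (gtens V W) x -> f t \in gcomp X x.
Proof.
move=> fP x t; rewrite memv_preim; move: t; apply/subvP.
apply: gtens_comp_sub => y z v w vy wz <-; rewrite -memv_preim; exact: fP.
Qed.

Lemma gtens_pres3 U V W X (f : 'Hom(gtens (gtens U V) W, X)) :
  (forall x y z u v w, u \in gcomp U x -> v \in gcomp V y -> w \in gcomp W z ->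
     f ((u ⊗ v) ⊗ w) \in gcomp X (x * y * z)%g) ->
  forall x t, t \in gcomp (gtens (gtens U V) W) x -> f t \in gcomp X x.
Proof.
move=> fP; apply: gtens_pres => x z t w tx wz; rewrite -tpurerE -comp_lfunE.
rewrite memv_preim; move: t tx; apply/subvP.
apply: gtens_comp_sub => a b u v ua vb <-.
by rewrite -memv_preim comp_lfunE tpurerE; apply: fP.
Qed.

Lemma gtens_pres3' U V W X (f : 'Hom(gtens U (gtens V W), X)) :
  (forall x y z u v w, u \in gcomp U x -> v \in gcomp V y -> w \in gcomp W z ->
     f (u ⊗ (v ⊗ w)) \in gcomp X (x * y * z)%g) ->
  forall x t, t \in gcomp (gtens U (gtens V W)) x -> f t \in gcomp X x.
Proof.
move=> fP; apply: gtens_pres => x z u t ux tz; rewrite -tpurelE -comp_lfunE.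
rewrite memv_preim; move: t tz; apply/subvP.
apply: gtens_comp_sub => a b v w va wb <-.
by rewrite -memv_preim comp_lfunE tpurelE mulgA; apply: fP.
Qed.

Lemma gid_pres V x v : v \in gcomp V x -> (\1%VF : 'End(V)) v \in gcomp V x.
Proof. by rewrite id_lfunE. Qed.

Definition gid V : ghom V V := GHom (@gid_pres V).

Lemma gcompose_pres U V W (g : ghom V W) (f : ghom U V) x u :
  u \in gcomp U x -> (val g \o val f)%VF u \in gcomp W x.
Proof. by move=> ux; rewrite comp_lfunE; do 2!apply: gapp_mem. Qed.

Definition gcompose U V W (g : ghom V W) (f : ghom U V) : ghom U W :=
  GHom (gcompose_pres g f).

Lemma gtensm_pres V V' W W' (f : ghom V V') (g : ghom W W') x t :
  t \in gcomp (gtens V W) x ->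
  (tmap (val f) (val g) : 'Hom(gtens V W, gtens V' W')) t
    \in gcomp (gtens V' W') x.
Proof.
move: x t; apply: gtens_pres => x y v w vx wy; rewrite tmapE.
by apply: gtens_comp_mem; apply: gapp_mem.
Qed.

Definition gtensm V V' W W' (f : ghom V V') (g : ghom W W') :
  ghom (gtens V W) (gtens V' W') := GHom (gtensm_pres f g).

(* [c x y z] times the canonical isomorphism on [U_x ⊗ V_y ⊗ W_z]. *)
Definition assoc_map (c : gT -> gT -> gT -> k) U V W :
    'Hom(gtens (gtens U V) W, gtens U (gtens V W)) :=
  tlift3 (fun (u : U) (v : V) (w : W) => \sum_x \sum_y \sum_z
    c x y z *: (gproj U x u ⊗ (gproj V y v ⊗ gproj W z w))).

Definition assocV_map (c : gT -> gT -> gT -> k) U V W :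
    'Hom(gtens U (gtens V W), gtens (gtens U V) W) :=
  tlift3' (fun (u : U) (v : V) (w : W) => \sum_x \sum_y \sum_z
    c x y z *: ((gproj U x u ⊗ gproj V y v) ⊗ gproj W z w)).

Lemma sum3_one (T : vectType k) (F : gT -> gT -> gT -> T) x y z :
  (forall a b c, (a, b, c) != (x, y, z) -> F a b c = 0) ->
  \sum_a \sum_b \sum_c F a b c = F x y z.
Proof.
move=> F0; rewrite (bigD1 x) //= [X in _ + X]big1 ?addr0 => [|a ax]; last first.
  by apply: big1 => b _; apply: big1 => c _; rewrite F0 // !xpair_eqE (negPf ax).
rewrite (bigD1 y) //= [X in _ + X]big1 ?addr0 => [|b byy]; last first.
  by apply: big1 => c _; rewrite F0 // !xpair_eqE (negPf byy) andbF.
rewrite (bigD1 z) //= [X in _ + X]big1 ?addr0 => [//|c cz].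
by rewrite F0 // !xpair_eqE (negPf cz) andbF.
Qed.

Lemma assoc_mapE c U V W x y z u v w :
  u \in gcomp U x -> v \in gcomp V y -> w \in gcomp W z ->
  assoc_map c U V W ((u ⊗ v) ⊗ w) = c x y z *: (u ⊗ (v ⊗ w)).
Proof.
move=> ux vy wz; rewrite tlift3E.
  rewrite (sum3_one (x := x) (y := y) (z := z)) => [|a b d].
    by rewrite (gproj_id _ ux) (gproj_id _ vy) (gproj_id _ wz) !eqxx.
  rewrite (gproj_id _ ux) (gproj_id _ vy) (gproj_id _ wz) !xpair_eqE.
  by do 3!case: eqP => _ //=; rewrite ?tpure0r ?tpure0l ?tpure0r scaler0.
split=> [s t|s t|s t] a p q; rewrite scaler_sumr -big_split /=;
  apply: eq_bigr => i _; rewrite scaler_sumr -big_split /=;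
  apply: eq_bigr => j _; rewrite scaler_sumr -big_split /=;
  apply: eq_bigr => l _; rewrite linearP ?tpurePl ?tpurePr ?tpurePl ?tpurePr;
  by rewrite scalerDr !scalerA mulrC.
Qed.

Lemma assocV_mapE c U V W x y z u v w :
  u \in gcomp U x -> v \in gcomp V y -> w \in gcomp W z ->
  assocV_map c U V W (u ⊗ (v ⊗ w)) = c x y z *: ((u ⊗ v) ⊗ w).
Proof.
move=> ux vy wz; rewrite tlift3'E.
  rewrite (sum3_one (x := x) (y := y) (z := z)) => [|a b d].
    by rewrite (gproj_id _ ux) (gproj_id _ vy) (gproj_id _ wz) !eqxx.
  rewrite (gproj_id _ ux) (gproj_id _ vy) (gproj_id _ wz) !xpair_eqE.
  by do 3!case: eqP => _ //=; rewrite ?tpure0r ?tpure0l ?tpure0r ?tpure0l scaler0.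
split=> [s t|s t|s t] a p q; rewrite scaler_sumr -big_split /=;
  apply: eq_bigr => i _; rewrite scaler_sumr -big_split /=;
  apply: eq_bigr => j _; rewrite scaler_sumr -big_split /=;
  apply: eq_bigr => l _; rewrite linearP ?tpurePl ?tpurePr ?tpurePl ?tpurePr;
  by rewrite scalerDr !scalerA mulrC.
Qed.

Lemma assoc_pres c U V W x t : t \in gcomp (gtens (gtens U V) W) x ->
  assoc_map c U V W t \in gcomp (gtens U (gtens V W)) x.
Proof.
move: x t; apply: gtens_pres3 => x y z u v w ux vy wz.
rewrite (assoc_mapE _ ux vy wz) rpredZ // -mulgA.
by do 2!apply: gtens_comp_mem => //.
Qed.

Lemma assocV_pres c U V W x t : t \in gcomp (gtens U (gtens V W)) x ->
  assocV_map c U V W t \in gcomp (gtens (gtens U V) W) x.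
Proof.
move: x t; apply: gtens_pres3' => x y z u v w ux vy wz.
rewrite (assocV_mapE _ ux vy wz) rpredZ //.
by do 2!apply: gtens_comp_mem => //.
Qed.

Definition lunit_map (c : gT -> k) V : 'Hom(gtens gunit V, V) :=
  tlift (fun (a : k^o) (v : V) => \sum_x c x *: ((a : k) *: gproj V x v)).

Definition lunitV_map (c : gT -> k) V : 'Hom(V, gtens gunit V) :=
  \sum_x c x *: (tpurel V (1 : k^o) \o gproj V x)%VF.

Definition runit_map (c : gT -> k) V : 'Hom(gtens V gunit, V) :=
  tlift (fun (v : V) (a : k^o) => \sum_x c x *: ((a : k) *: gproj V x v)).

Definition runitV_map (c : gT -> k) V : 'Hom(V, gtens V gunit) :=
  \sum_x c x *: (tpurer V (1 : k^o) \o gproj V x)%VF.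

Lemma sum1_one (T : vectType k) (c : gT -> k) (t : T) x :
  \sum_y c y *: (if y == x then t else 0) = c x *: t.
Proof.
rewrite (bigD1 x) //= eqxx big1 ?addr0 // => y /negPf->.
by rewrite scaler0.
Qed.

Lemma lunit_mapE c V x v (a : k^o) : v \in gcomp V x ->
  lunit_map c V (a ⊗ v) = c x *: ((a : k) *: v).
Proof.
move=> vx; rewrite tliftE.
  rewrite -(sum1_one c _ x); apply: eq_bigr => y _.
  by rewrite (gproj_id _ vx); case: eqP; rewrite ?scaler0.
split=> s b p q; rewrite scaler_sumr -big_split; apply: eq_bigr => y _ /=.
  by rewrite scalerDl scalerDr -!scalerA [c y *: (b *: _)]scalerA mulrC -scalerA.
by rewrite linearP !scalerDr !scalerA; congr (_ *: _ + _); ring.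
Qed.

Lemma runit_mapE c V x v (a : k^o) : v \in gcomp V x ->
  runit_map c V (v ⊗ a) = c x *: ((a : k) *: v).
Proof.
move=> vx; rewrite tliftE.
  rewrite -(sum1_one c _ x); apply: eq_bigr => y _.
  by rewrite (gproj_id _ vx); case: eqP; rewrite ?scaler0.
split=> s b p q; rewrite scaler_sumr -big_split; apply: eq_bigr => y _ /=.
  by rewrite linearP !scalerDr !scalerA; congr (_ *: _ + _); ring.
by rewrite scalerDl scalerDr -!scalerA [c y *: (b *: _)]scalerA mulrC -scalerA.
Qed.

Lemma lunitV_mapE c V x v : v \in gcomp V x ->
  lunitV_map c V v = c x *: ((1 : k^o) ⊗ v).
Proof.
move=> vx; rewrite sum_lfunE -(sum1_one c _ x); apply: eq_bigr => y _.
rewrite scale_lfunE comp_lfunE tpurelE (gproj_id _ vx).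
by case: eqP; rewrite ?tpure0r.
Qed.

Lemma runitV_mapE c V x v : v \in gcomp V x ->
  runitV_map c V v = c x *: (v ⊗ (1 : k^o)).
Proof.
move=> vx; rewrite sum_lfunE -(sum1_one c _ x); apply: eq_bigr => y _.
rewrite scale_lfunE comp_lfunE tpurerE (gproj_id _ vx).
by case: eqP; rewrite ?tpure0l.
Qed.

Lemma gunit_mem (a : k^o) : a \in gcomp gunit 1%g.
Proof. by rewrite /= /gunit_comp eqxx memvf. Qed.

Lemma gunit_memE (a : k^o) x : a \in gcomp gunit x -> a = 0 \/ x = 1%g.
Proof.
rewrite /= /gunit_comp; case: eqP => [|_]; first by right.
by rewrite memv0 => /eqP; left.
Qed.

Lemma lunit_pres c V x t : t \in gcomp (gtens gunit V) x ->
  lunit_map c V t \in gcomp V x.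
Proof.
move: x t; apply: gtens_pres => x y a v /gunit_memE[->|->] vy.
  by rewrite tpure0l linear0 mem0v.
by rewrite (lunit_mapE _ _ vy) mul1g !rpredZ.
Qed.

Lemma runit_pres c V x t : t \in gcomp (gtens V gunit) x ->
  runit_map c V t \in gcomp V x.
Proof.
move: x t; apply: gtens_pres => y x v a vy /gunit_memE[->|->].
  by rewrite tpure0r linear0 mem0v.
by rewrite (runit_mapE _ _ vy) mulg1 !rpredZ.
Qed.

Lemma lunitV_pres c V x v : v \in gcomp V x ->
  lunitV_map c V v \in gcomp (gtens gunit V) x.
Proof.
move=> vx; rewrite (lunitV_mapE _ vx) rpredZ // -[x]mul1g.
exact: gtens_comp_mem (gunit_mem _) vx.
Qed.

Lemma runitV_pres c V x v : v \in gcomp V x ->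
  runitV_map c V v \in gcomp (gtens V gunit) x.
Proof.
move=> vx; rewrite (runitV_mapE _ vx) rpredZ // -[x]mulg1.
exact: gtens_comp_mem vx (gunit_mem _).
Qed.

Record normalized_cocycle3 (omega : gT -> gT -> gT -> k) : Prop :=
  NormalizedCocycle3 {
  cocycle3_neq0 : forall x y z, omega x y z != 0;
  cocycle3P : forall g1 g2 g3 g4 : gT,
    omega (g1 * g2)%g g3 g4 * omega g1 g2 (g3 * g4)%g =
    omega g1 g2 g3 * omega g1 (g2 * g3)%g g4 * omega g2 g3 g4;
  cocycle3_norm : forall x y z,
    [\/ x = 1%g, y = 1%g | z = 1%g] -> omega x y z = 1
}.

Section Vec.
Variables (omega : gT -> gT -> gT -> k) (omegaP : normalized_cocycle3 omega).

Definition gassoc U V W : ghom (gtens (gtens U V) W) (gtens U (gtens V W)) :=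
  GHom (@assoc_pres (fun x y z => (omega x y z)^-1) U V W).

Definition gassocV U V W : ghom (gtens U (gtens V W)) (gtens (gtens U V) W) :=
  GHom (@assocV_pres omega U V W).

Definition glunit V : ghom (gtens gunit V) V :=
  GHom (@lunit_pres (fun x => (omega 1%g 1%g x)^-1) V).

Definition glunitV V : ghom V (gtens gunit V) :=
  GHom (@lunitV_pres (fun x => omega 1%g 1%g x) V).

Definition grunit V : ghom (gtens V gunit) V :=
  GHom (@runit_pres (fun x => omega x 1%g 1%g) V).

Definition grunitV V : ghom V (gtens V gunit) :=
  GHom (@runitV_pres (fun x => (omega x 1%g 1%g)^-1) V).

Let omega_neq0 := cocycle3_neq0 omegaP.

Lemma gassoc_nat U U' V V' W W' (f : ghom U U') (g : ghom V V') (h : ghom W W') :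
  gcompose (gassoc U' V' W') (gtensm (gtensm f g) h) =
  gcompose (gtensm f (gtensm g h)) (gassoc U V W).
Proof.
apply/ghomP/gtens_ext3 => x y z u v w ux vy wz /=.
rewrite !comp_lfunE (assoc_mapE _ ux vy wz) linearZ /= !tmapE.
by rewrite (assoc_mapE _ (gapp_mem f ux) (gapp_mem g vy) (gapp_mem h wz)).
Qed.

Lemma gassocK U V W : gcompose (gassocV U V W) (gassoc U V W) = gid _.
Proof.
apply/ghomP/gtens_ext3 => x y z u v w ux vy wz /=.
rewrite comp_lfunE id_lfunE (assoc_mapE _ ux vy wz) linearZ /=.
by rewrite (assocV_mapE _ ux vy wz) scalerA mulVf // scale1r.
Qed.

Lemma gassocVK U V W : gcompose (gassoc U V W) (gassocV U V W) = gid _.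
Proof.
apply/ghomP/gtens_ext3' => x y z u v w ux vy wz /=.
rewrite comp_lfunE id_lfunE (assocV_mapE _ ux vy wz) linearZ /=.
by rewrite (assoc_mapE _ ux vy wz) scalerA mulfV // scale1r.
Qed.

Lemma gtensm1 V W : gtensm (gid V) (gid W) = gid (gtens V W).
Proof. by apply/ghomP/tens_ext => v w /=; rewrite tmapE !id_lfunE. Qed.

Lemma gtensm_comp U U' U'' V V' V'' (f' : ghom U' U'') (f : ghom U U')
    (g' : ghom V' V'') (g : ghom V V') :
  gtensm (gcompose f' f) (gcompose g' g) = gcompose (gtensm f' g') (gtensm f g).
Proof.
by apply/ghomP/tens_ext => v w /=; rewrite comp_lfunE !tmapE !comp_lfunE.
Qed.

Lemma glunit_nat V W (f : ghom V W) :
  gcompose (glunit W) (gtensm (gid gunit) f) = gcompose f (glunit V).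
Proof.
apply/ghomP/gtens_ext => x y a v _ vy /=.
rewrite !comp_lfunE tmapE id_lfunE (lunit_mapE _ _ vy).
by rewrite (lunit_mapE _ _ (gapp_mem f vy)) !lfunZ.
Qed.

Lemma grunit_nat V W (f : ghom V W) :
  gcompose (grunit W) (gtensm f (gid gunit)) = gcompose f (grunit V).
Proof.
apply/ghomP/gtens_ext => y x v a vy _ /=.
rewrite !comp_lfunE tmapE id_lfunE (runit_mapE _ _ vy).
by rewrite (runit_mapE _ _ (gapp_mem f vy)) !lfunZ.
Qed.

Lemma glunitK V : gcompose (glunitV V) (glunit V) = gid _.
Proof.
apply/ghomP/gtens_ext => x y a v _ vy /=.
rewrite comp_lfunE id_lfunE (lunit_mapE _ _ vy) !linearZ /=.
rewrite (lunitV_mapE _ vy) !scalerA -tpureZl mulrAC mulVf // mul1r.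
by congr (_ ⊗ _); rewrite /GRing.scale /= mulr1.
Qed.

Lemma glunitVK V : gcompose (glunit V) (glunitV V) = gid _.
Proof.
apply/ghomP/gext => x v vx /=.
rewrite comp_lfunE id_lfunE (lunitV_mapE _ vx) linearZ /= (lunit_mapE _ _ vx).
by rewrite scale1r scalerA mulfV ?scale1r.
Qed.

Lemma grunitK V : gcompose (grunitV V) (grunit V) = gid _.
Proof.
apply/ghomP/gtens_ext => y x v a vy _ /=.
rewrite comp_lfunE id_lfunE (runit_mapE _ _ vy) !linearZ /=.
rewrite (runitV_mapE _ vy) !scalerA -tpureZr mulrAC mulfV // mul1r.
by congr (_ ⊗ _); rewrite /GRing.scale /= mulr1.
Qed.

Lemma grunitVK V : gcompose (grunit V) (grunitV V) = gid _.
Proof.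
apply/ghomP/gext => x v vx /=.
rewrite comp_lfunE id_lfunE (runitV_mapE _ vx) linearZ /= (runit_mapE _ _ vx).
by rewrite scale1r scalerA mulVf ?scale1r.
Qed.

Lemma gpentagon U V W X :
  gcompose (gtensm (gid U) (gassoc V W X))
    (gcompose (gassoc U (gtens V W) X) (gtensm (gassoc U V W) (gid X))) =
  gcompose (gassoc U V (gtens W X)) (gassoc (gtens U V) W X).
Proof.
apply/ghomP/gtens_ext4 => x y z t u v w s ux vy wz st /=.
rewrite !comp_lfunE tmapE id_lfunE (assoc_mapE _ ux vy wz) tpureZl !lfunZ.
rewrite (assoc_mapE _ ux (gtens_mem vy wz) st) lfunZ tmapE id_lfunE.
rewrite (assoc_mapE _ vy wz st) (assoc_mapE _ (gtens_mem ux vy) wz st).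
rewrite lfunZ (assoc_mapE _ ux vy (gtens_mem wz st)) tpureZr !scalerA.
by rewrite -!invfM; congr (_^-1 *: _); rewrite (cocycle3P omegaP); ring.
Qed.

Lemma gtriangle V W :
  gcompose (gtensm (gid V) (glunit W)) (gassoc V gunit W) =
  gtensm (grunit V) (gid W).
Proof.
apply/ghomP/gtens_ext3 => x y z v a w vx _ wz /=.
rewrite comp_lfunE (assoc_mapE _ vx (gunit_mem a) wz) linearZ /= !tmapE.
rewrite !id_lfunE (lunit_mapE _ _ wz) (runit_mapE _ _ vx).
rewrite !(cocycle3_norm omegaP) ?invr1 ?scale1r ?tpureZl ?tpureZr //;
  by [constructor 1|constructor 2|constructor 3].
Qed.

Lemma gcompose1f V W (f : ghom V W) : gcompose (gid W) f = f.
Proof. by apply/ghomP/comp_lfun1l. Qed.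

Lemma gcomposef1 V W (f : ghom V W) : gcompose f (gid V) = f.
Proof. by apply/ghomP/comp_lfun1r. Qed.

Lemma gcomposeA U V W X (h : ghom W X) (g : ghom V W) (f : ghom U V) :
  gcompose h (gcompose g f) = gcompose (gcompose h g) f.
Proof. by apply/ghomP/comp_lfunA. Qed.

Definition VecG : monoidal := Monoidal gcompose1f gcomposef1 gcomposeA
  gtensm1 gtensm_comp gassoc_nat glunit_nat grunit_nat gassocK gassocVK
  glunitK glunitVK grunitK grunitVK gpentagon gtriangle.

End Vec.

Section TwistedGroupAlgebra.
Variable L : {group gT}.

Definition tga_delta (h : subg_of L) : {ffun subg_of L -> k^o} :=
  [ffun h' => (h' == h)%:R].

(* [<[tga_delta h]>] when [x = sgval h], and [0] when [x \notin L]. *)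
Definition tga_comp (x : gT) : {vspace {ffun subg_of L -> k^o}} :=
  (\sum_(h : subg_of L | sgval h == x) <[tga_delta h]>)%VS.

Definition tga_part x (f : {ffun subg_of L -> k^o}) : {ffun subg_of L -> k^o} :=
  [ffun h => f h *+ (sgval h == x)].

Lemma tga_part_linear x : linear (tga_part x).
Proof.
move=> a f g; apply/ffunP=> h; rewrite !ffunE.
by case: eqP => _; rewrite ?mulr1n ?mulr0n // scaler0 addr0.
Qed.

HB.instance Definition _ x :=
  GRing.isLinear.Build k {ffun subg_of L -> k^o} {ffun subg_of L -> k^o} _
    (tga_part x) (tga_part_linear x).

Lemma tga_direct : direct_family tga_comp.
Proof.
apply: (directv_proj (P := fun x => linfun (tga_part x))) => x y f; rewrite /tga_comp.
pose Q : 'End({ffun subg_of L -> k^o}) := if x == y then \1%VF else 0.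
have -> : (if x == y then f else 0) = Q f.
  by rewrite /Q; case: ifP => _; rewrite ?id_lfunE ?zero_lfunE.
move: f; apply/eqlfun_inP/subv_sumP => h /eqP hy.
rewrite -memvE; apply/eqlfunP; rewrite lfunE /=; apply/ffunP=> h'.
rewrite !ffunE /Q -hy; case: (x =P sgval h) => [->|xh].
  rewrite id_lfunE ffunE (inj_eq val_inj).
  by case: eqP => _; rewrite ?mulr1n ?mulr0n.
rewrite zero_lfunE ffunE; case: (h' =P h) => [->|_]; last exact: mul0rn.
by rewrite eq_sym (introF eqP xh) mulr0n.
Qed.

Lemma tga_full : (\sum_x tga_comp x)%VS = fullv.
Proof.
apply/eqP; rewrite eqEsubv subvf; apply/subvP=> f _.
have -> : f = \sum_h f h *: tga_delta h.
  apply/ffunP=> h; rewrite sum_ffunE (bigD1 h) //= !ffunE eqxx big1 ?addr0.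
    by rewrite /GRing.scale /= mulr1.
  by move=> h' h'h; rewrite !ffunE eq_sym (negPf h'h) scaler0.
apply: rpred_sum => h _; apply: rpredZ.
have /subvP : (tga_comp (sgval h) <= \sum_x tga_comp x)%VS.
  exact: (sumv_sup (sgval h)).
apply; have /subvP : (<[tga_delta h]> <= tga_comp (sgval h))%VS.
  exact: (sumv_sup h).
by apply; apply: memv_line.
Qed.

(* The graded vector space underlying [A(L, psi)]; only the multiplication
   depends on [psi]. *)
Definition tga : gvect := GVect tga_direct tga_full.

Definition cochain2 (psi : subg_of L -> subg_of L -> k) :=
  forall f g, psi f g != 0.

Definition normalized2 (psi : subg_of L -> subg_of L -> k) :=
  forall f, psi f 1%g = 1 /\ psi 1%g f = 1.

Definition coboundary_eq (psi : subg_of L -> subg_of L -> k)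
    (omega : gT -> gT -> gT -> k) :=
  forall f1 f2 f3 : subg_of L,
    psi f1 (f2 * f3)%g * psi f2 f3 =
    omega (sgval f1) (sgval f2) (sgval f3) * psi (f1 * f2)%g f3 * psi f1 f2.

Definition trivial_class_on (omega : gT -> gT -> gT -> k) :=
  exists2 psi, cochain2 psi & coboundary_eq psi omega.

End TwistedGroupAlgebra.

End Graded.

(* Main.v *)
(* With x = gh, the comultiplication reads
     Delta(g) = |L|^-1 sum_(xy = g) psi(x, y)^-1 (x ⊗ y),
   so every axiom other than the (co)unit ones reduces, on basis vectors and
   after matching summands, to d psi = omega at a single triple: (a, b, c) for
   (co)associativity, (a, x, y) and (x, y, b) for the Frobenius identities on
   a ⊗ b with b = xy and a = xy respectively. *)

Require Import Defs.
From HB Require Import structures.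
From mathcomp Require Import all_boot all_order all_algebra all_fingroup.
From mathcomp Require Import ring.
Import GRing.Theory.
Local Open Scope ring_scope.

Set Implicit Arguments.
Unset Strict Implicit.
Unset Printing Implicit Defensive.

(** * Linear maps out of [A] and its tensor powers, tested and defined on basis vectors *)

Section LinearExtension.
Variables (k : fieldType) (gT : finGroupType) (L : {group gT}).
Implicit Types (T : vectType k) (V : gvect k gT).
Local Notation A := (tga k L).
Local Notation delta := (tga_delta k (L := L)).

Lemma tga_delta_sum (f : {ffun subg_of L -> k^o}) :
  f = \sum_h (f h : k) *: delta h.
Proof.
apply/ffunP=> h; rewrite sum_ffunE (bigD1 h) //= !ffunE eqxx big1 ?addr0.
  by rewrite /GRing.scale /= mulr1.
by move=> h' h'h; rewrite !ffunE eq_sym (negPf h'h) scaler0.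
Qed.

Lemma tga_delta_mem h : (delta h : A) \in gcomp A (sgval h).
Proof.
have /subvP : (<[delta h]> <= tga_comp k L (sgval h))%VS by apply: (sumv_sup h).
by apply; apply: memv_line.
Qed.

Lemma tga_ext T (f g : 'Hom(A, T)) :
  (forall h, f (delta h) = g (delta h)) -> f = g.
Proof.
move=> fg; apply/lfunP=> v; rewrite (tga_delta_sum v) !linear_sum.
by apply: eq_bigr => h _; rewrite !linearZ /= fg.
Qed.

Lemma tga_ext2 T (f g : 'Hom(tens A A, T)) :
  (forall a b, f (delta a ⊗ delta b) = g (delta a ⊗ delta b)) -> f = g.
Proof.
move=> fg; apply: tens_ext => v w.
rewrite (tga_delta_sum v) (tga_delta_sum w) tpure_suml !linear_sum.
apply: eq_bigr => a _; rewrite tpure_sumr !linear_sum.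
by apply: eq_bigr => b _; rewrite tpureZl tpureZr !linearZ /= fg.
Qed.

Lemma tga_ext3 T (f g : 'Hom(tens (tens A A) A, T)) :
  (forall a b c, f ((delta a ⊗ delta b) ⊗ delta c) =
                 g ((delta a ⊗ delta b) ⊗ delta c)) -> f = g.
Proof.
move=> fg; apply: tens_ext3 => u v w.
rewrite (tga_delta_sum u) (tga_delta_sum v) (tga_delta_sum w).
do ![rewrite !(tpure_suml, linear_sum) /=; apply: eq_bigr => ? _].
by rewrite !(tpureZl, tpureZr) !linearZ /= fg.
Qed.

(** The degree [x] component of [A] is a sum of lines spanned by basis vectors, and preserving
    degree means that this component lies in the preimage under [f] of a subspace, so the generators
    of the lines suffice. *)
Lemma tga_pres V (f : 'Hom(A, V)) :
  (forall h, f (delta h) \in gcomp V (sgval h)) ->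
  forall x v, v \in gcomp A x -> f v \in gcomp V x.
Proof.
move=> fP x v; rewrite memv_preim; move: v; apply/subvP.
apply/subv_sumP => h /eqP <-; rewrite -memvE -memv_preim; exact: fP.
Qed.

Lemma tga_pres2 V (f : 'Hom(gtens A A, V)) :
  (forall a b, f (delta a ⊗ delta b) \in gcomp V (sgval a * sgval b)%g) ->
  forall x t, t \in gcomp (gtens A A) x -> f t \in gcomp V x.
Proof.
move=> fP; apply: gtens_pres => x y v w vx wy.
(* One tensor factor is varied at a time: first the left one, with a basis vector on the right, then
   the right one. Tensoring with a fixed vector is a linear map, so each pass is again an inclusion
   in a preimage. *)
have fbP b z u : u \in gcomp A z ->
    f (u ⊗ delta b) \in gcomp V (z * sgval b)%g.
  rewrite -tpurerE -comp_lfunE memv_preim; move: u; apply/subvP/subv_sumP.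
  by move=> h /eqP <-; rewrite -memvE -memv_preim comp_lfunE tpurerE fP.
rewrite -tpurelE -comp_lfunE memv_preim; move: w wy; apply/subvP/subv_sumP.
by move=> h /eqP <-; rewrite -memvE -memv_preim comp_lfunE tpurelE fbP.
Qed.

(** The linear extension of [e], given by the universal property of the vector space with basis
    [delta]. *)
Definition tga_lift_fun T (e : subg_of L -> T)
    (f : {ffun subg_of L -> k^o}) : T := \sum_h (f h : k) *: e h.

Lemma tga_lift_fun_linear T (e : subg_of L -> T) : linear (tga_lift_fun e).
Proof.
move=> a f g; rewrite /tga_lift_fun scaler_sumr -big_split.
by apply: eq_bigr => h _ /=; rewrite !ffunE scalerDl scalerA.
Qed.

HB.instance Definition _ T (e : subg_of L -> T) :=
  GRing.isLinear.Build k {ffun subg_of L -> k^o} T _ (tga_lift_fun e)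
    (tga_lift_fun_linear e).

Definition tga_lift T (e : subg_of L -> T) : 'Hom(A, T) :=
  linfun (tga_lift_fun e).

Lemma tga_liftE T (e : subg_of L -> T) h : tga_lift e (delta h) = e h.
Proof.
rewrite lfunE /= /tga_lift_fun (bigD1 h) //= ffunE eqxx scale1r big1 ?addr0 //.
by move=> h' h'h; rewrite ffunE (negPf h'h) scale0r.
Qed.

Definition tga_lift2 T (e : subg_of L -> subg_of L -> T) : 'Hom(tens A A, T) :=
  tlift (fun v w : A => tga_lift (fun a => tga_lift (e a) w) v).

Lemma tga_lift2E T (e : subg_of L -> subg_of L -> T) a b :
  tga_lift2 e (delta a ⊗ delta b) = e a b.
Proof.
(* [tlift] computes on pure tensors only for a bilinear argument. Linearity on the left comes from
   the outer lift; on the right it is checked coefficient by coefficient. *)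
rewrite tliftE ?tga_liftE //; split=> [w|v] c x y; first by rewrite linearP.
rewrite !lfunE /= /tga_lift_fun scaler_sumr -big_split; apply: eq_bigr => h _ /=.
by rewrite linearP scalerDr !scalerA mulrC.
Qed.

End LinearExtension.

(** * The four structure maps and their values on basis vectors *)

Section Frobenius.
Variables (k : fieldType) (gT : finGroupType).
Variables (omega : gT -> gT -> gT -> k) (omegaP : normalized_cocycle3 omega).
Variables (L : {group gT}) (psi : subg_of L -> subg_of L -> k).
Hypotheses (psi_neq0 : cochain2 psi) (psi1 : normalized2 psi).
Hypotheses (dpsi : coboundary_eq psi omega) (L_neq0 : #|L|%:R != 0 :> k).
Local Notation A := (tga k L).
Local Notation delta := (tga_delta k (L := L)).
Local Notation n := (#|L|%:R : k).

Definition tga_mul_map : 'Hom(gtens A A, A) :=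
  tga_lift2 (fun a b => psi a b *: delta (a * b)%g).

Definition tga_unit_fun (c : k^o) : A := (c : k) *: delta 1%g.

Lemma tga_unit_fun_linear : linear tga_unit_fun.
Proof. by move=> a c d; rewrite /tga_unit_fun scalerDl -scalerA. Qed.

HB.instance Definition _ :=
  GRing.isLinear.Build k k^o A _ tga_unit_fun tga_unit_fun_linear.

Definition tga_unit_map : 'Hom(gunit k gT, A) := linfun tga_unit_fun.

Definition tga_comul_map : 'Hom(A, gtens A A) :=
  tga_lift (fun g => n^-1 *: \sum_(h : subg_of L)
    (psi (g * h)%g (h^-1)%g)^-1 *: (delta (g * h)%g ⊗ delta (h^-1)%g)).

Definition tga_counit_map : 'Hom(A, gunit k gT) :=
  tga_lift (fun g => ((g == 1%g)%:R * n) *: gunit_delta k gT).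

Lemma tga_mulE a b :
  tga_mul_map (delta a ⊗ delta b) = psi a b *: delta (a * b)%g.
Proof. exact: tga_lift2E. Qed.

Lemma tga_unitE (c : k^o) : tga_unit_map c = (c : k) *: delta 1%g.
Proof. exact: lfunE. Qed.

(** The substitution [h = g^-1 * x] indexes the sum by the factorizations of [g] as [x] times
    [x^-1 * g]; summands on the two sides of an axiom are matched in this form. *)
Lemma tga_comulE g : tga_comul_map (delta g) =
  n^-1 *: \sum_x (psi x (x^-1 * g)%g)^-1 *: (delta x ⊗ delta (x^-1 * g)%g).
Proof.
rewrite tga_liftE (reindex_inj (mulgI g^-1%g)); congr (_ *: _).
by apply: eq_bigr => x _; rewrite mulKVg invMg invgK.
Qed.

Lemma tga_counitE g :
  tga_counit_map (delta g) = ((g == 1%g)%:R * n) *: gunit_delta k gT.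
Proof. exact: tga_liftE. Qed.

(** * The structure maps preserve the grading *)

Lemma tga_mul_pres x t :
  t \in gcomp (gtens A A) x -> tga_mul_map t \in gcomp A x.
Proof.
move: x t; apply: tga_pres2 => a b.
by rewrite tga_mulE rpredZ // -sgvalM ?in_setT ?tga_delta_mem.
Qed.

Lemma tga_unit_pres x c :
  c \in gcomp (gunit k gT) x -> tga_unit_map c \in gcomp A x.
Proof.
case/gunit_memE=> ->; first by rewrite linear0 mem0v.
by rewrite tga_unitE rpredZ // tga_delta_mem.
Qed.

Lemma tga_comul_pres x v :
  v \in gcomp A x -> tga_comul_map v \in gcomp (gtens A A) x.
Proof.
move: x v; apply: tga_pres => g; rewrite tga_comulE.
apply: rpredZ; apply: rpred_sum => x _; apply: rpredZ.
(* Only the degree is rewritten, into the product of the degrees of the two factors. *)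
by rewrite -[g in gcomp _ (sgval g)](mulKVg x) gtens_mem ?tga_delta_mem.
Qed.

Lemma tga_counit_pres x v :
  v \in gcomp A x -> tga_counit_map v \in gcomp (gunit k gT) x.
Proof.
move: x v; apply: tga_pres => g; rewrite tga_counitE.
case: eqP => [->|_]; first by rewrite rpredZ // gunit_mem.
by rewrite mul0r scale0r mem0v.
Qed.

Definition tga_mul : ghom (gtens A A) A := GHom tga_mul_pres.
Definition tga_unit : ghom (gunit k gT) A := GHom tga_unit_pres.
Definition tga_comul : ghom A (gtens A A) := GHom tga_comul_pres.
Definition tga_counit : ghom A (gunit k gT) := GHom tga_counit_pres.

Lemma tga_assocE a b c :
  assoc_map (fun x y z => (omega x y z)^-1) A A A ((delta a ⊗ delta b) ⊗ delta c) =
  (omega (sgval a) (sgval b) (sgval c))^-1 *: (delta a ⊗ (delta b ⊗ delta c)).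
Proof.
have mem := @tga_delta_mem k _ L.
by rewrite (assoc_mapE _ (mem a) (mem b) (mem c)).
Qed.

Lemma tga_assocVE a b c :
  assocV_map omega A A A (delta a ⊗ (delta b ⊗ delta c)) =
  omega (sgval a) (sgval b) (sgval c) *: ((delta a ⊗ delta b) ⊗ delta c).
Proof.
have mem := @tga_delta_mem k _ L.
by rewrite (assocV_mapE _ (mem a) (mem b) (mem c)).
Qed.

(** * Associativity and unit laws *)

Let omega_neq0 := cocycle3_neq0 omegaP.

Lemma tga_mulA :
  gcompose tga_mul (gtensm tga_mul (gid A)) =
  gcompose tga_mul (gcompose (gtensm (gid A) tga_mul) (gassoc omega A A A)).
Proof.
apply/ghomP/tga_ext3 => a b c /=.
rewrite !comp_lfunE tga_assocE tmapE id_lfunE tga_mulE tpureZl !lfunZ.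
rewrite tga_mulE tmapE id_lfunE tga_mulE tpureZr lfunZ tga_mulE mulgA.
rewrite !scalerA; congr (_ *: _).
(* The associator contributes the inverse of [omega] at (a, b, c), which cancels the factor produced
   by [dpsi]. *)
by rewrite -mulrA [psi b c * _]mulrC dpsi -mulrA mulKf // mulrC.
Qed.

Lemma tga_mul1l : gcompose tga_mul (gtensm tga_unit (gid A)) = glunit omega A.
Proof.
apply/ghomP/tens_ext => c v /=.
rewrite (tga_delta_sum v) tpure_sumr !linear_sum; apply: eq_bigr => a _.
rewrite tpureZr !linearZ /=; congr (_ *: _); rewrite comp_lfunE tmapE id_lfunE.
rewrite tga_unitE tpureZl lfunZ tga_mulE mul1g (lunit_mapE _ _ (tga_delta_mem k a)).
(* Both remaining scalars, [psi] at (1, a) and the inverse of [omega] at (1, 1, a), are 1 by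
   normalization. *)
by rewrite (psi1 a).2 (cocycle3_norm omegaP) ?invr1 ?scale1r //; constructor 1.
Qed.

Lemma tga_mul1r : gcompose tga_mul (gtensm (gid A) tga_unit) = grunit omega A.
Proof.
apply/ghomP/tens_ext => v c /=.
rewrite (tga_delta_sum v) tpure_suml !linear_sum; apply: eq_bigr => a _.
rewrite tpureZl !linearZ /=; congr (_ *: _); rewrite comp_lfunE tmapE id_lfunE.
rewrite tga_unitE tpureZr lfunZ tga_mulE mulg1 (runit_mapE _ _ (tga_delta_mem k a)).
by rewrite (psi1 a).1 (cocycle3_norm omegaP) ?scale1r //; constructor 2.
Qed.

(** * Coassociativity and counit laws *)

Lemma tga_comulA :
  gcompose (gassoc omega A A A) (gcompose (gtensm tga_comul (gid A)) tga_comul) =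
  gcompose (gtensm (gid A) tga_comul) tga_comul.
Proof.
apply/ghomP/tga_ext => g /=.
rewrite !comp_lfunE tga_comulE !lfunZ; congr (_ *: _).
rewrite !linear_sum /=.
(* The left side becomes a double sum over factorizations of [g] into three: [x] comes from the
   outer comultiplication, and [a] from splitting [x] again. *)
transitivity (n^-1 *: \sum_x \sum_a ((psi x (x^-1 * g)%g)^-1 *
    (psi a (a^-1 * x)%g)^-1 *
    (omega (sgval a) (sgval (a^-1 * x)%g) (sgval (x^-1 * g)%g))^-1)
    *: (delta a ⊗ (delta (a^-1 * x)%g ⊗ delta (x^-1 * g)%g))).
  rewrite scaler_sumr; apply: eq_bigr => x _.
  rewrite !lfunZ tmapE id_lfunE tga_comulE tpureZl lfunZ scalerA mulrC -scalerA.
  congr (_ *: _); rewrite tpure_suml linear_sum scaler_sumr.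
  by apply: eq_bigr => a _; rewrite tpureZl linearZ /= tga_assocE !scalerA.
(* On the right the first factor [a] is split off first, so [a] has to become the outer index. *)
rewrite exchange_big scaler_sumr; apply: eq_bigr => a _.
rewrite !lfunZ tmapE id_lfunE tga_comulE tpureZr scalerA [in RHS]mulrC -scalerA.
(* With [x = a * y] on the left, both sides run over the middle factor [y]. *)
congr (_ *: _); rewrite tpure_sumr scaler_sumr (reindex_inj (mulgI a)).
apply: eq_bigr => y _; rewrite tpureZr scalerA mulKg invMg -mulgA; congr (_ *: _).
have := dpsi a y (y^-1 * (a^-1 * g))%g; rewrite mulKVg => d.
by rewrite -!invfM d; congr (_^-1); ring.
Qed.

Lemma tga_comul1l :
  gcompose (gtensm tga_counit (gid A)) tga_comul = glunitV omega A.
Proof.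
apply/ghomP/tga_ext => g /=.
rewrite comp_lfunE tga_comulE lfunZ linear_sum (lunitV_mapE _ (tga_delta_mem k g)).
(* The counit kills every summand whose left factor is not the identity. *)
rewrite (bigD1 1%g) //= big1 ?addr0 => [|x /negPf x1]; last first.
  by rewrite linearZ /= tmapE tga_counitE x1 mul0r scale0r tpure0l scaler0.
rewrite linearZ /= tmapE tga_counitE id_lfunE eqxx mul1r invg1 mul1g (psi1 g).2.
(* The factor |L| of the counit cancels the |L|^-1 of the comultiplication, since [L_neq0] makes |L|
   invertible in [k]. *)
rewrite invr1 scale1r tpureZl scalerA mulVf // (cocycle3_norm omegaP) //.
by constructor 1.
Qed.

Lemma tga_comul1r :
  gcompose (gtensm (gid A) tga_counit) tga_comul = grunitV omega A.
Proof.
apply/ghomP/tga_ext => g /=.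
rewrite comp_lfunE tga_comulE lfunZ linear_sum (runitV_mapE _ (tga_delta_mem k g)).
(* The right factor [x^-1 * g] is the identity exactly when [x = g]. *)
rewrite (bigD1 g) //= big1 ?addr0 => [|x xg]; last first.
  rewrite linearZ /= tmapE tga_counitE -eq_mulVg1 (negPf xg) mul0r scale0r.
  by rewrite tpure0r scaler0.
rewrite linearZ /= tmapE tga_counitE id_lfunE mulVg eqxx mul1r (psi1 g).1.
rewrite invr1 scale1r tpureZr scalerA mulVf // (cocycle3_norm omegaP) ?invr1 //.
by constructor 2.
Qed.

(** * The two Frobenius identities *)

Lemma tga_frobl :
  gcompose (gtensm tga_mul (gid A))
    (gcompose (gassocV omega A A A) (gtensm (gid A) tga_comul)) =
  gcompose tga_comul tga_mul.
Proof.
apply/ghomP/tga_ext2 => a b /=.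
rewrite !comp_lfunE tmapE id_lfunE tga_mulE lfunZ !tga_comulE tpureZr !lfunZ.
rewrite scalerA [in RHS]mulrC -scalerA; congr (_ *: _).
(* Multiplying by [a] turns the left factor [x] of a summand of the comultiplication of [b] into
   [a * x], so the factorizations of [a * b] are indexed by [a * x]. *)
rewrite tpure_sumr !linear_sum /= [RHS](reindex_inj (mulgI a)).
apply: eq_bigr => x _; rewrite tpureZr !linearZ /= tga_assocVE lfunZ tmapE.
rewrite id_lfunE tga_mulE tpureZl !scalerA invMg -mulgA mulKg; congr (_ *: _).
have := dpsi a x (x^-1 * b)%g; rewrite mulKVg => d.
rewrite -mulrA mulrC [RHS]mulrC; apply/eqP.
(* The coefficients are fractions with values of [psi] as denominators; cross-multiplied, their
   equality is [d]. *)
by rewrite eqr_div ?psi_neq0 // d; apply/eqP; ring.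
Qed.

Lemma tga_frobr :
  gcompose (gtensm (gid A) tga_mul)
    (gcompose (gassoc omega A A A) (gtensm tga_comul (gid A))) =
  gcompose tga_comul tga_mul.
Proof.
apply/ghomP/tga_ext2 => a b /=.
rewrite !comp_lfunE tmapE id_lfunE tga_mulE lfunZ !tga_comulE tpureZl !lfunZ.
rewrite scalerA [in RHS]mulrC -scalerA; congr (_ *: _).
rewrite tpure_suml !linear_sum /=.
(* Right multiplication by [b] leaves the left factor [x] alone, so the summands match without
   reindexing. *)
apply: eq_bigr => x _; rewrite tpureZl !linearZ /= tga_assocE lfunZ tmapE.
rewrite id_lfunE tga_mulE tpureZr !scalerA -mulgA; congr (_ *: _).
have := dpsi x (x^-1 * a)%g b; rewrite mulKVg -mulgA => d.
rewrite -invfM mulrC [RHS]mulrC; apply/eqP.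
rewrite eqr_div ?mulf_neq0 ?psi_neq0 ?omega_neq0 //; apply/eqP.
by rewrite [LHS]mulrC d; ring.
Qed.

End Frobenius.

(** * Assembly of the Frobenius algebra over a field of characteristic 0 *)

Theorem proposition5p7 (k : closedFieldType) (k_char0 : [pchar k] =i pred0)
    (G : finGroupType) (omega : G -> G -> G -> k)
    (omegaP : normalized_cocycle3 omega)
    (L : {group G}) (omegaL : trivial_class_on L omega)
    (psi : subg_of L -> subg_of L -> k)
    (psi_cochain : cochain2 psi) (psi_normalized : normalized2 psi)
    (dpsi : coboundary_eq psi omega) :
  exists F : @frobenius (VecG omegaP) (tga k L),
    [/\ forall g g' : subg_of L,
          gapp (fmul F) (tga_delta k g ⊗ tga_delta k g') =
          psi g g' *: tga_delta k (g * g')%g,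
        gapp (funit F) (gunit_delta k G) = tga_delta k 1%g,
        forall g : subg_of L,
          gapp (fcomul F) (tga_delta k g) =
          (#|L|%:R)^-1 *: \sum_(h : subg_of L) (psi (g * h)%g (h^-1)%g)^-1 *:
            (tga_delta k (g * h)%g ⊗ tga_delta k (h^-1)%g)
      & forall g : subg_of L,
          gapp (fcounit F) (tga_delta k g) =
          ((g == 1%g)%:R * #|L|%:R) *: gunit_delta k G].
Proof.
have L_neq0 : #|L|%:R != 0 :> k.
  (* In characteristic 0 a natural number vanishes in [k] only if it is 0, and a group has at least
     one element. *)
  by rewrite ((pcharf0P k).1 k_char0) -lt0n cardG_gt0.
exists (@Frobenius (VecG omegaP) (tga k L)
  (tga_mul psi) (tga_unit k L) (tga_comul psi) (tga_counit k L)
  (tga_mulA omegaP dpsi) (tga_mul1l omegaP psi_normalized)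
  (tga_mul1r omegaP psi_normalized) (tga_comulA dpsi)
  (tga_comul1l omegaP psi_normalized L_neq0)
  (tga_comul1r omegaP psi_normalized L_neq0)
  (tga_frobl psi_cochain dpsi) (tga_frobr omegaP psi_cochain dpsi)).
split=> [g g'||g|g].
- exact: tga_mulE.
- by rewrite [LHS]tga_unitE scale1r.
(* The required formula is summed over [h], as in the definition of [tga_comul_map], rather than in
   the reindexed form [tga_comulE]. *)
- exact: tga_liftE.
- exact: tga_counitE.
Qed.
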